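(* Let $G$ be a group and $\mathbb{K}\in\{\mathbb{R},\mathbb{C}\}$. Every partial cotranslation $W:G\times G\to\mathcal{M}_d(\mathbb{K})$ is conjugated to a partial cotranslation $\widehat{W}:G\times G\to\mathcal{M}_d(\mathbb{K})$ whose projector of the units space is constant and orthogonal, i.e. $$\widehat{W}(g,e)=\begin{pmatrix}\mathrm{Id}_{\mathrm{rank}\,W}&0\\0&0\end{pmatrix},\qquad\forall\,g\in G,$$ where $\mathrm{Id}_{\mathrm{rank}\,W}$ is the identity on $\mathbb{K}^{\mathrm{rank}\,W}$.
   Context: $e$ is the unit of $G$; $\mathcal{M}_d(\mathbb{K})$ is the space of $d\times d$ matrices over $\mathbb{K}$ and $GL_d(\mathbb{K})$ the general linear group. A function $W:G\times G\to\mathcal{M}_d(\mathbb{K})$ is a partial cotranslation if $W(g,kh)=W(hg,k)W(g,h)$ for all $g,h,k\in G$. The rank of $W(g,h)$ does not depend on $(g,h)$, and $\mathrm{rank}\,W$ denotes this common value. The projector of the units space of $W$ is the map $g\mapsto W(g,e)$. Two partial cotranslations $W,V$ are conjugated if there is a map $T:G\to GL_d(\mathbb{K})$ such that $T(hg)V(g,h)=W(g,h)T(g)$ for all $g,h\in G$. *)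

(* Defs.v *)
From HB Require Import structures.
From mathcomp Require Import all_boot all_order all_algebra.
From mathcomp Require Import reals complex.

Set Implicit Arguments.
Unset Strict Implicit.
Unset Printing Implicit Defensive.

Import GRing.Theory.
Local Open Scope ring_scope.

Variant scalar_kind := RealScalars | ComplexScalars.

Definition scalar_field (R : realType) (k : scalar_kind) : fieldType :=
  match k with
  | RealScalars => R
  | ComplexScalars => R[i]
  end.

Section Cotranslation.
Variables (K : fieldType) (G : groupType) (d : nat).
Implicit Types W V : G -> G -> 'M[K]_d.

Definition partial_cotranslation W : Prop :=
  forall g h k : G, W g (k * h)%g = W (h * g)%g k *m W g h.

Definition units_projector W (g : G) : 'M[K]_d := W g 1%g.

(* Value at (1, 1); the rank is the same everywhere by [cotranslation_rankE]. *)
Definition cotranslation_rank W : nat := \rank (W 1%g 1%g).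

Lemma cotranslation_rankE W (hW : partial_cotranslation W) (g h : G) :
  \rank (W g h) = cotranslation_rank W.
Proof.
have le_r a b c : (\rank (W a b) <= \rank (W a c))%N.
  by rewrite -[b](mulgVK c) hW mxrankM_maxr.
have le_l a b k : (\rank (W a b) <= \rank (W (b * a) k)%g)%N.
  by rewrite (leq_trans (le_r a b (k * b)%g)) // hW mxrankM_maxl.
have le a b : (\rank (W a 1%g) <= \rank (W b 1%g))%N.
  apply: leq_trans (le_r _ _ (b * a^-1)%g) _.
  by have := le_l a (b * a^-1)%g 1%g; rewrite mulgVK.
by apply/eqP; rewrite eqn_leq; apply/andP; split;
  [apply: leq_trans (le_r _ _ 1%g) (le _ _) | apply: leq_trans (le _ _) (le_r _ _ _)].
Qed.

Definition conjugated W V : Prop :=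
  exists T : G -> 'M[K]_d,
    (forall g : G, T g \in unitmx) /\
    (forall g h : G, T (h * g)%g *m V g h = W g h *m T g).

End Cotranslation.

(* Main.v *)
Require Import Defs.
From mathcomp Require Import all_boot all_order all_algebra.
From mathcomp Require Import reals.

(** Since [W g 1] is idempotent of rank [rank W], it is conjugated by some
    invertible [T g] to the standard projector; conjugating [W] by [T] gives the
    required partial cotranslation. *)

Import GRing.Theory.
Local Open Scope ring_scope.

(** The cotranslation identity at [h = k = 1] makes each [W g 1] idempotent, and any family of
    invertible matrices conjugates [W] to a partial cotranslation. So the points [g] can be treated
    separately: it suffices to diagonalise one idempotent ([idempotent_frameE],
    [idempotent_frame_unit]), and constancy of the rank makes the resulting projector the same for
    all [g]. *)

(* If [P = L E U] with [E = pid_mx (\rank P)], then [L E] spans the image of [P]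
   and [U^-1 (1 - E)] spans its kernel. *)
Definition idempotent_frame {K : fieldType} {d : nat} (P : 'M[K]_d) : 'M[K]_d :=
  col_ebase P *m pid_mx (\rank P) + invmx (row_ebase P) *m copid_mx (\rank P).

Section IdempotentFrame.
Variables (K : fieldType) (d : nat) (P : 'M[K]_d).
Hypothesis idemP : P *m P = P.

Let E : 'M[K]_d := pid_mx (\rank P).
Let L := col_ebase P.
Let U := row_ebase P.

Let idemE : E *m E = E.
Proof. by rewrite pid_mx_id ?rank_leq_row. Qed.

(** Cancel the invertible [L] and [U] in [L E U L E U = L E U]: the leading block of [U L] is the
    identity. *)
Let factor_idem : E *m (U *m L) *m E = E.
Proof.
have := idemP; rewrite -(mulmx_ebase P) -/E -/L -/U => eqP.
apply: (can_inj (mulKmx (col_ebase_unit P))).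
apply: (can_inj (mulmxK (row_ebase_unit P))).
by rewrite -/L -/U -[RHS]eqP !mulmxA.
Qed.

(** Both sides reduce to [L E]: [P] fixes it by [factor_idem] and kills [U^-1 (1 - E)]. *)
Lemma idempotent_frameE :
  P *m idempotent_frame P = idempotent_frame P *m pid_mx (\rank P).
Proof.
rewrite /idempotent_frame /copid_mx -/E -/L -/U mulmxDr mulmxDl.
rewrite -[P in LHS]mulmx_ebase -/E -/L -/U.
rewrite -!mulmxA mulmxBl mul1mx idemE subrr mulmx0 addr0.
rewrite (mulKVmx (row_ebase_unit P)) mulmxBr mulmx1 idemE subrr mulmx0 addr0.
by have := factor_idem; rewrite -!mulmxA => ->.
Qed.

(** Multiplied by [U] on the left, the frame becomes block unitriangular, [1 + N] with [N] of square
    zero, hence has inverse [1 - N]. *)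
Lemma idempotent_frame_unit : idempotent_frame P \in unitmx.
Proof.
pose N := U *m L *m E - E.
have EN : E *m N = 0 by rewrite mulmxBr mulmxA factor_idem idemE subrr.
have NE : N *m E = N by rewrite mulmxBl -(mulmxA _ E) idemE.
have NN : N *m N = 0 by rewrite -{1}NE -mulmxA EN mulmx0.
have UT : U *m idempotent_frame P = 1%:M + N.
  rewrite /idempotent_frame /copid_mx -/E -/L -/U mulmxDr.
  by rewrite (mulKVmx (row_ebase_unit P)) mulmxA addrCA.
have : U *m idempotent_frame P *m (1%:M - N) = 1%:M.
  by rewrite UT mulmxDl mul1mx mulmxBr mulmx1 NN subr0 subrK.
by move=> /mulmx1_unit[]; rewrite unitmx_mul => /andP[].
Qed.

End IdempotentFrame.

Section Conjugation.
Variables (K : fieldType) (G : groupType) (d : nat).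
Variables (W : G -> G -> 'M[K]_d) (hW : partial_cotranslation W).

Lemma units_projector_idem (g : G) :
  units_projector W g *m units_projector W g = units_projector W g.
Proof. by have := hW g 1%g 1%g; rewrite !mul1g. Qed.

(** The inner factors [T (h * g)] and its inverse cancel, so no relation between the values of [T]
    is required. *)
Lemma conj_partial_cotranslation (T : G -> 'M[K]_d) :
    (forall g, T g \in unitmx) ->
  partial_cotranslation (fun g h => invmx (T (h * g)%g) *m W g h *m T g).
Proof.
by move=> uT g h k; rewrite hW -!mulmxA (mulKVmx (uT _)) mulgA.
Qed.

End Conjugation.

Theorem proposition5p17 (R : realType) (k : scalar_kind) (G : groupType)
    (d : nat) (W : G -> G -> 'M[scalar_field R k]_d)
    (hW : partial_cotranslation W) :
  exists What : G -> G -> 'M[scalar_field R k]_d,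
    partial_cotranslation What /\
    conjugated W What /\
    forall g : G, units_projector What g = pid_mx (cotranslation_rank W).
Proof.
pose T g := idempotent_frame (units_projector W g).
have uT g : T g \in unitmx.
  exact: idempotent_frame_unit (units_projector_idem _ _ _ _ hW g).
exists (fun g h => invmx (T (h * g)%g) *m W g h *m T g); split.
  exact: conj_partial_cotranslation.
split; first by exists T; split=> // g h; rewrite -mulmxA (mulKVmx (uT _)).
move=> g; rewrite /units_projector mul1g -mulmxA -/(units_projector W g).
rewrite (idempotent_frameE _ _ _ (units_projector_idem _ _ _ _ hW g)).
(* The projector obtained has rank [\rank (W g 1)], which does not depend on [g]. *)
by rewrite (mulKmx (uT g)) (cotranslation_rankE hW).
Qed.
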